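(* Let $\alpha$ be a continuous action of a countable group $G$ on a proper metric space $(X,d_X)$. If $\alpha$ is expansive and has the pseudo-orbit tracing property (POTP), then $\alpha$ is strongly GH-stable. More precisely: (1) if $c>0$ is an expansive constant of $\alpha$, then for every $0<\varepsilon<c$ there exists $\delta>0$ such that if $\beta$ is a continuous action of a topological group $H$ on a metric space $(Y,d_Y)$ with $d_{GH,1}(\alpha,\beta)<\delta$, then there exist an $\varepsilon$-isometry $h:Y\to X$ and a homomorphism $\rho:G\to H$ satisfying $\alpha_g\circ h=h\circ\beta_{\rho(g)}$ for every $g\in G$; (2) if furthermore $Y$ is compact, then the $\varepsilon$-isometry $h$ in (1) can be chosen to be continuous.
   Context: A metric space is proper if every closed ball is compact. For an action $\alpha$ write $\alpha_g$ for the map given by $g$. Expansive: $\alpha$ is expansive if there is $c>0$ (an expansive constant) such that $\sup_{g\in G}d_X(\alpha_g x,\alpha_g y)>c$ for all $x\neq y$ in $X$. POTP: for $\delta>0$ and $S\subset G$, a $(\delta,S)$ pseudo-orbit of $\alpha$ is a family $\{x_g\}_{g\in G}$ in $X$ with $d_X(\alpha_s(x_g),x_{sg})<\delta$ for all $s\in S$, $g\in G$. The action $\alpha$ has POTP if for every $\varepsilon>0$ there exist $\delta>0$ and a finite subset $S$ of $G$ such that for every $(\delta,S)$ pseudo-orbit $\{x_g\}_{g\in G}$ there is $x\in X$ with $d_X(\alpha_g(x),x_g)<\varepsilon$ for every $g\in G$. $\varepsilon$-isometry: a map $f:Y\to X$ (not necessarily continuous) between metric spaces such that $|d_X(f(y_1),f(y_2))-d_Y(y_1,y_2)|\le\varepsilon$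 for all $y_1,y_2\in Y$, and every $x\in X$ satisfies $d_X(x,f(y))\le\varepsilon$ for some $y\in Y$. It is also called an $\varepsilon$-GH approximation. Distance $d_{GH,1}$: for actions $\alpha$ of $G$ on $X$ and $\beta$ of $H$ on $Y$, $d_{GH,1}(\alpha,\beta)$ is the infimum of the $\varepsilon>0$ for which there are a group homomorphism $\rho:G\to H$ and an $\varepsilon$-isometry $f:Y\to X$ with $\sup_{g\in G}\sup_{y\in Y}d_X(\alpha_g(f(y)),f(\beta_{\rho(g)}(y)))\le\varepsilon$ (and $\infty$ if there is no such $\varepsilon$). Strongly GH-stable: $\alpha$ is strongly GH-stable if for every $\varepsilon>0$ there is $\delta>0$ such that for every continuous action $\beta$ of a topological group $H$ on a metric space $Y$ with $d_{GH,1}(\alpha,\beta)<\delta$ there are a continuous $\varepsilon$-isometry $h:Y\to X$ and a homomorphism $\rho:G\to H$ such that $\alpha_g\circ h=h\circ\beta_{\rho(g)}$ for every $g\in G$. *)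

(* Defs.v *)
From HB Require Import structures.
From mathcomp Require Import all_boot all_order all_algebra.
From mathcomp Require Import all_classical all_reals all_analysis.

Set Implicit Arguments.
Unset Strict Implicit.
Unset Printing Implicit Defensive.
Import Order.TTheory GRing.Theory Num.Theory.
Import numFieldNormedType.Exports.
Local Open Scope classical_set_scope.
Local Open Scope ring_scope.

HB.mixin Record isTopologicalGroup (H : Type) of Topological H & Group H := {
  mulg_continuous : continuous (fun p : H * H => (p.1 * p.2)%g) ;
  invg_continuous : continuous (fun x : H => (x^-1)%g)
}.

#[short(type="topologicalGroupType")]
HB.structure Definition TopologicalGroup :=
  {H of Topological H & Group H & isTopologicalGroup H}.

(* Actions of arbitrary groups; the actions of fingroup are finite. *)
Record gaction (G : groupType) (X : Type) := GAction {
  gact :> G -> X -> X ;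
  gact1 : forall x, gact 1%g x = x ;
  gactM : forall g h x, gact (g * h)%g x = gact g (gact h x)
}.

(* Continuity of an action of a group carrying no topology, i.e. a discrete
   group. *)
Definition continuous_discrete_action (G : groupType) (X : topologicalType)
    (alpha : gaction G X) : Prop :=
  forall g : G, continuous (alpha g).

Definition continuous_action (H : topologicalGroupType) (Y : topologicalType)
    (beta : gaction H Y) : Prop :=
  continuous (fun p : H * Y => beta p.1 p.2).

(* The library's [closed_ball] is the closure of the open ball, which may be
   smaller than the closed ball. *)
Definition proper_metric (R : realType) (X : metricType R) : Prop :=
  forall (x : X) (r : R), compact [set y : X | mdist x y <= r].

Definition expansive_constant (R : realType) (G : groupType) (X : metricType R)
    (alpha : gaction G X) (c : R) : Prop :=
  0 < c /\
  forall x y : X, x <> y ->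
    (c%:E < ereal_sup (range (fun g : G => (mdist (alpha g x) (alpha g y))%:E)))%E.

Definition expansive (R : realType) (G : groupType) (X : metricType R)
    (alpha : gaction G X) : Prop :=
  exists c : R, expansive_constant alpha c.

Definition pseudo_orbit (R : realType) (G : groupType) (X : metricType R)
    (alpha : gaction G X) (delta : R) (S : set G) (x : G -> X) : Prop :=
  forall s g : G, S s -> mdist (alpha s (x g)) (x (s * g)%g) < delta.

Definition POTP (R : realType) (G : groupType) (X : metricType R)
    (alpha : gaction G X) : Prop :=
  forall eps : R, 0 < eps ->
    exists (delta : R) (S : set G),
      [/\ 0 < delta, finite_set S &
        forall x : G -> X, pseudo_orbit alpha delta S x ->
          exists z : X, forall g : G, mdist (alpha g z) (x g) < eps].

Definition eps_isometry (R : realType) (Y X : metricType R) (eps : R)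
    (f : Y -> X) : Prop :=
  (forall y1 y2 : Y, `|mdist (f y1) (f y2) - mdist y1 y2| <= eps) /\
  (forall x : X, exists y : Y, mdist x (f y) <= eps).

Definition dGH1 (R : realType) (G H : groupType) (X Y : metricType R)
    (alpha : gaction G X) (beta : gaction H Y) : \bar R :=
  ereal_inf [set eps%:E | eps in [set eps : R | 0 < eps /\
    exists (rho : {multiplicative G -> H}) (f : Y -> X),
      eps_isometry eps f /\
      (ereal_sup (range (fun g : G => ereal_sup (range (fun y : Y =>
         (mdist (alpha g (f y)) (f (beta (rho g) y)))%:E)))) <= eps%:E)%E]].

Definition strongly_GH_stable (R : realType) (G : groupType) (X : metricType R)
    (alpha : gaction G X) : Prop :=
  forall eps : R, 0 < eps ->
    exists delta : R, 0 < delta /\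
      forall (H : topologicalGroupType) (Y : metricType R) (beta : gaction H Y),
        continuous_action beta -> (dGH1 alpha beta < delta%:E)%E ->
        exists (h : Y -> X) (rho : {multiplicative G -> H}),
          [/\ continuous h, eps_isometry eps h &
            forall g : G, alpha g \o h = h \o beta (rho g)].

(* Main.v *)
Require Import Defs.
From HB Require Import structures.
From mathcomp Require Import all_boot all_order all_algebra.
From mathcomp Require Import all_classical all_reals all_analysis.
From mathcomp Require Import lra.
Import Order.TTheory GRing.Theory Num.Theory.
Import numFieldNormedType.Exports.
Local Open Scope classical_set_scope.
Local Open Scope ring_scope.

(** Fix an almost equivariant [eps']-isometry [f : Y -> X] with homomorphism
    [rho], as provided by a small value of the distance between the two actions.
    For each [y] the family [f (beta (rho g) y)] is a pseudo-orbit of [alpha]: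
    moving it by [alpha s] changes the index to [s * g] up to the equivariance
    defect of [f].  By POTP it is traced by the orbit of a point, called [h y],
    and [h] is uniformly close to [f], hence an isometry up to a small error
    ([eps_isometry_perturb]).

    Expansiveness makes [h] rigid.  Both [alpha g (h y)] and
    [h (beta (rho g) y)] trace the pseudo-orbit of [beta (rho g) y], and two
    points tracing the same pseudo-orbit coincide; so [h] is equivariant
    ([tracing_map_equivariant]).

    The same rigidity gives continuity ([tracing_map_continuous]): the
    values of [h] near [y] stay in a bounded set, which is relatively compact
    because [X] is proper, and any of their cluster points has an orbit that
    stays close to the orbit of [h y], because for a fixed [g] the point
    [f (beta (rho g) y')] is within about [eps'] of [f (beta (rho g) y)] once
    [y'] is near [y].  By expansiveness the only cluster point is [h y]. *)

Lemma cvg_compact_sole_cluster {T : topologicalType} {x : T} {F : set_system T}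
    {V : set T} :
  hausdorff_space T -> compact V -> nbhs x V -> ProperFilter F -> F V ->
  cluster F `<=` [set x] -> F --> x.
Proof.
move=> hT cV xV PF FV clF.
apply: (compact_cluster_set1 hT cV xV PF FV); apply/seteqP; split=> // _ ->.
by have [z [_ clz]] := cV F PF FV; rewrite -(clF z clz).
Qed.

(** A multiplicative map need not preserve the unit between monoids; between
    groups it does, by cancellation in [rho 1 * rho 1 = rho 1]. *)
Lemma group_multiplicative1 {G H : groupType} (rho : {multiplicative G -> H}) :
  rho 1%g = 1%g.
Proof. by apply: (@mulgI _ (rho 1%g)); rewrite -gmulfM !mulg1. Qed.

Definition tracing_map {R : realType} {G H : groupType} {X Y : metricType R}
    (alpha : gaction G X) (beta : gaction H Y) (rho : G -> H) (f h : Y -> X)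
    (eta : R) : Prop :=
  forall y g, mdist (alpha g (h y)) (f (beta (rho g) y)) < eta.

Section tracing.
Context {R : realType} {G H : groupType} {X Y : metricType R}.
Context {alpha : gaction G X} {beta : gaction H Y}.

Lemma expansive_orbits_eq {c : R} {x y : X} :
  expansive_constant alpha c ->
  (forall g, mdist (alpha g x) (alpha g y) <= c) -> x = y.
Proof.
move=> [_ expc] xy; apply: contrapT => /expc; apply/negP; rewrite -leNgt.
by apply: ge_ereal_sup => _ [g _ <-]; rewrite lee_fin.
Qed.

Lemma dGH1_lt {delta : R} :
  (dGH1 alpha beta < delta%:E)%E ->
  exists eps (rho : {multiplicative G -> H}) (f : Y -> X),
    [/\ eps < delta, eps_isometry eps f &
      forall g y, mdist (alpha g (f y)) (f (beta (rho g) y)) <= eps].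
Proof.
move=> /ereal_inf_lt [_ [eps [eps0 [rho [f [fiso sup_le]]]] <-]].
rewrite lte_fin => eps_delta; exists eps, rho, f; split=> // g y.
rewrite -lee_fin (le_trans _ sup_le)//.
apply: le_trans (ereal_sup_ubound _); last by exists g.
by apply: ereal_sup_ubound; exists y.
Qed.

Lemma pseudo_orbit_pullback {rho : {multiplicative G -> H}} {f : Y -> X}
    {eps delta : R} (S : set G) (y : Y) :
  eps < delta ->
  (forall g y, mdist (alpha g (f y)) (f (beta (rho g) y)) <= eps) ->
  pseudo_orbit alpha delta S (fun g => f (beta (rho g) y)).
Proof.
move=> eps_delta feq s g _; apply: le_lt_trans eps_delta.
by rewrite gmulfM gactM.
Qed.

Lemma tracing_map_close {rho : {multiplicative G -> H}} {f h : Y -> X}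
    {eta : R} :
  tracing_map alpha beta rho f h eta -> forall y, mdist (h y) (f y) < eta.
Proof.
by move=> trh y; have := trh y 1%g; rewrite group_multiplicative1 !gact1.
Qed.

Lemma eps_isometry_perturb {f h : Y -> X} {eps eta : R} :
  eps_isometry eps f -> (forall y, mdist (h y) (f y) <= eta) ->
  eps_isometry (eps + eta *+ 2) h.
Proof.
move=> [fd fsurj] hf; split=> [y1 y2|x].
  have := fd y1 y2; rewrite !ler_norml => /andP[lo up].
  have := hf y1; have := hf y2.
  have := metric_triangle (h y1) (f y1) (h y2).
  have := metric_triangle (f y1) (f y2) (h y2).
  have := metric_triangle (f y1) (h y1) (f y2).
  have := metric_triangle (h y1) (h y2) (f y2).
  rewrite (metric_sym (f y2) (h y2)) (metric_sym (f y1) (h y1)).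
  by move=> *; apply/andP; split; lra.
have [y xfy] := fsurj x; exists y.
have := metric_triangle x (f y) (h y); have := hf y.
have := mdist_ge0 (h y) (f y).
by rewrite (metric_sym (f y) (h y)); lra.
Qed.

Lemma tracing_map_equivariant {rho : {multiplicative G -> H}} {f h : Y -> X}
    {eta c : R} :
  expansive_constant alpha c -> eta *+ 2 <= c ->
  tracing_map alpha beta rho f h eta ->
  forall g, alpha g \o h = h \o beta (rho g).
Proof.
move=> expc etac trh g; apply/funext => y /=.
apply: (expansive_orbits_eq expc) => k.
have := trh (beta (rho g) y) k; have := trh y (k * g)%g.
rewrite gmulfM !gactM => t1 t2.
have := metric_triangle (alpha k (alpha g (h y)))
  (f (beta (rho k) (beta (rho g) y)))
  (alpha k (h (beta (rho g) y))).
by rewrite (metric_sym (f _) (alpha k _)); lra.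
Qed.

(** For each [g] separately, [alpha g (h y')] stays close to [alpha g (h y)]
    once [y'] is near [y], how near depending on [g].  This is enough: the bound
    passes to a cluster point of [h] at [y] by continuity of the single map
    [alpha g], and only there is it used for all [g] at once. *)
Lemma tracing_map_continuous {rho : {multiplicative G -> H}} {f h : Y -> X}
    {eps eta c : R} :
  proper_metric X -> continuous_discrete_action alpha ->
  (forall g, continuous (beta (rho g))) ->
  expansive_constant alpha c -> eps + eta *+ 2 < c ->
  eps_isometry eps f -> tracing_map alpha beta rho f h eta -> continuous h.
Proof.
move=> propX ctsa ctsb expc epsc [fd _] trh y.
(* The slack in [epsc] is spent twice: on moving [y'] away from [y], and on
   approaching a cluster point [z]. *)
pose t := (c - (eps + eta *+ 2)) / 2.
have t0 : 0 < t by rewrite divr_gt0// subr_gt0.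
have tE : eps + eta *+ 2 + t + t = c by rewrite /t; lra.
have near_orbit g : \forall y' \near y,
    mdist (alpha g (h y)) (alpha g (h y')) <= eps + eta *+ 2 + t.
  apply: filterS (metricType_numDomainType.cvgr_dist_lt (ctsb g y) t0).
  move=> y' yy'.
  have := fd (beta (rho g) y) (beta (rho g) y').
  rewrite ler_norml => /andP[_ ff'].
  have := trh y g; have := trh y' g.
  have := metric_triangle (alpha g (h y)) (f (beta (rho g) y)) (alpha g (h y')).
  have := metric_triangle (f (beta (rho g) y)) (f (beta (rho g) y'))
    (alpha g (h y')).
  by rewrite (metric_sym (f (beta (rho g) y')) (alpha g _)); lra.
apply: (@cvg_compact_sole_cluster _ _ _ [set x | mdist (h y) x <= c]).
- exact: metric_hausdorff.
- exact: propX.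
- rewrite -metricType_numDomainType.nbhs_nbhs_mdist.
  by exists c => /=; [case: expc | move=> x /ltW].
- apply: filterS (near_orbit 1%g) => y' /=.
  by rewrite !gact1; lra.
- move=> z clz; apply/esym/(expansive_orbits_eq expc) => g.
  have [x [/= hx zx]] := clz
    [set x | mdist (alpha g (h y)) (alpha g x) <= eps + eta *+ 2 + t] _
    (near_orbit g)
    (metricType_numDomainType.cvgr_dist_lt (ctsa g z) t0).
  have := metric_triangle (alpha g (h y)) (alpha g x) (alpha g z).
  by rewrite (metric_sym (alpha g x) (alpha g z)); lra.
Qed.

End tracing.

Lemma continuous_action_at {H : topologicalGroupType} {Y : topologicalType}
    {beta : gaction H Y} (k : H) :
  continuous_action beta -> continuous (beta k).
Proof.
move=> ctsb y.
apply: (@cvg_comp _ _ _ (fun y => (k, y)) (fun p => beta p.1 p.2) _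
  (nbhs (k, y))); last exact: ctsb (k, y).
exact: (cvg_pair (cvg_cst k) cvg_id).
Qed.

(** The tracing precision is [eta = min(eps, c) / 4] and the distance of the
    actions is kept below [eta] as well: the isometry error is then less than
    [3 * eta <= eps], and the orbits compared by expansiveness are less than
    [3 * eta] apart up to an arbitrarily small slack, while [3 * eta < c]. *)
Lemma expansive_POTP_stable {R : realType} {G : groupType} {X : metricType R}
    {alpha : gaction G X} {c eps : R} :
  proper_metric X -> continuous_discrete_action alpha ->
  POTP alpha -> expansive_constant alpha c -> 0 < eps ->
  exists delta : R, 0 < delta /\
    forall (H : topologicalGroupType) (Y : metricType R) (beta : gaction H Y),
      continuous_action beta -> (dGH1 alpha beta < delta%:E)%E ->
      exists (h : Y -> X) (rho : {multiplicative G -> H}),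
        [/\ continuous h, eps_isometry eps h &
          forall g : G, alpha g \o h = h \o beta (rho g)].
Proof.
move=> propX ctsa potp expc eps0; have c0 : 0 < c by case: expc.
pose eta := Num.min eps c / 4.
have eta0 : 0 < eta by rewrite divr_gt0// lt_min eps0.
have [eta_eps eta_c] : eta * 4 <= eps /\ eta * 4 <= c.
  by rewrite divfK//; split; rewrite ge_min lexx ?orbT.
have [d [S [d0 _ shadow]]] := potp eta eta0.
exists (Num.min d eta); split; first by rewrite lt_min d0.
move=> H Y beta ctsb /dGH1_lt [e [rho [f [+ fiso feq]]]].
rewrite lt_min => /andP[e_d e_eta].
have [h trh] := choice (fun y =>
  shadow _ (pseudo_orbit_pullback S y e_d feq)).
exists h, rho; split.
- have ctsb_rho g : continuous (beta (rho g)) by exact: continuous_action_at.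
  apply: (tracing_map_continuous propX ctsa ctsb_rho expc _ fiso trh).
  by lra.
- have [hd hsurj] := eps_isometry_perturb fiso
    (fun y => ltW (tracing_map_close trh y)).
  have le_eps : e + eta *+ 2 <= eps by lra.
  split=> [y1 y2|x]; first exact: le_trans (hd y1 y2) le_eps.
  by have [y xy] := hsurj x; exists y; exact: le_trans le_eps.
- by apply: (tracing_map_equivariant expc _ trh); lra.
Qed.

Theorem theorem1p1 (R : realType) (G : groupType) (X : metricType R)
    (alpha : gaction G X)
    (countable_G : countable [set: G])
    (proper_X : proper_metric X)
    (continuous_alpha : continuous_discrete_action alpha)
    (expansive_alpha : expansive alpha)
    (POTP_alpha : POTP alpha) :
  strongly_GH_stable alpha /\
  (forall c : R, expansive_constant alpha c ->
   forall eps : R, 0 < eps -> eps < c ->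
   exists delta : R, 0 < delta /\
     forall (H : topologicalGroupType) (Y : metricType R) (beta : gaction H Y),
       continuous_action beta -> (dGH1 alpha beta < delta%:E)%E ->
       (exists (h : Y -> X) (rho : {multiplicative G -> H}),
          eps_isometry eps h /\
          forall g : G, alpha g \o h = h \o beta (rho g)) /\
       (compact [set: Y] ->
        exists (h : Y -> X) (rho : {multiplicative G -> H}),
          [/\ continuous h, eps_isometry eps h &
            forall g : G, alpha g \o h = h \o beta (rho g)])).
Proof.
split.
  move=> eps eps0; have [c expc] := expansive_alpha.
  exact: (expansive_POTP_stable proper_X continuous_alpha POTP_alpha
    expc eps0).
move=> c expc eps eps0 _.
have [delta [delta0 stab]] :=
  expansive_POTP_stable proper_X continuous_alpha POTP_alpha expc eps0.
exists delta; split=> // H Y beta ctsb /(stab _ _ _ ctsb) stab_h.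
split=> //; have [h [rho [_ hiso heq]]] := stab_h.
by exists h, rho.
Qed.
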